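(* Let $n$ be a natural number, let $X$ be any locally ordered space, and let $\beta_X:\tilde X\to X$ be its $n$-blowup map. Then for every euclidean local order $E$ of dimension $n$ and every local embedding $f:E\to X$ there is a unique continuous map $\tilde f:E\to\tilde X$ such that $\beta_X\circ\tilde f=f$. Moreover, $\tilde f$ is a local embedding.
   Context: An ordered space is a topological space with a partial order; a dihomeomorphism is an isomorphism of ordered spaces (a homeomorphism which is an order isomorphism). An ordered base $\mathcal B$ of a topological space $X$ is a collection of posets whose underlying sets form a base of the topology of $X$ and such that for all $B,B'\in\mathcal B$ and $x\in B\cap B'$ there is $B''\in\mathcal B$ with $x\in B''\subseteq B\cap B'$ and $B''$ a subposet of both $B$ and $B'$. A locally ordered space (or local order) is a topological space equipped with an ordered base; elements of the base are called ordered open sets, and an ordered neighborhood of $x$ is an ordered open set containing $x$. Convention: open subsets of ordered open sets, with the induced order, are also regarded as ordered open sets. A subset $A\subseteq X$ carries the induced local order with ordered base $\{B\cap A\mid B\in\mathcal B\}$. A morphism (resp. local embedding) of local orders $f:X\to Y$ is a continuous map such that for every $x\in X$ and every ordered neighborhood $V$ of $f(x)$ there is an ordered neighborhood $U$ of $x$ with $f(U)\subseteq V$ and $f|_U$ order preserving (resp. order preserving and admitting a continuous order preserving inverse on its image). A local order is euclidean of dimension $n$ ($n$-euclidean) if every point has an ordered neighborhood dihomeomorphic to $\mathbb R^n$ with the product topology and product order (the empty local order is euclidean). For a local order $X$ and $U\subseteq X$ open, let $\mathcal O^n_X(U)=\{A\subseteq U\mid A\cong E \text{ as local orders for some } n\text{-euclidean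 local order } E\}$, with restriction maps $A\mapsto A\cap U$ for $U\subseteq V$. Its stalk at $x$ is $\mathcal O^n_{X,x}=\operatorname{colim}_{V\ni x}\mathcal O^n_X(V)$, and $A_x$ denotes the germ of $A$ at $x$ (so $A_x=A'_x$ iff $A\cap W=A'\cap W$ for some neighborhood $W$ of $x$). Let $B(\mathcal O^n_X)=\bigsqcup_{x\in X}\mathcal O^n_{X,x}$ with projection $\beta^+_X$ to $X$, with the local order whose ordered base consists of the sets $U^+_A=\{A_y\mid y\in U\}$ for $U$ an ordered open set and $A\in\mathcal O^n_X(U)$, ordered as $U$. The $n$-blowup of $X$ is $\tilde X=\bigsqcup_{x\in X}\{A_x\in\mathcal O^n_{X,x}\mid x\in A\}\subseteq B(\mathcal O^n_X)$ with the induced topology and local order, and the $n$-blowup map $\beta_X:\tilde X\to X$ is the restriction of $\beta_X^+$. *)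

(* Defs.v *)
From HB Require Import structures.
From mathcomp Require Import all_boot all_order all_algebra.
From mathcomp Require Import all_classical all_reals.
From mathcomp Require Import topology normedtype.
From mathcomp Require Import ring lra.

Set Implicit Arguments.
Unset Strict Implicit.
Unset Printing Implicit Defensive.

Import Order.TTheory GRing.Theory Num.Theory.
Import numFieldNormedType.Exports.

Local Open Scope classical_set_scope.
Local Open Scope ring_scope.

(* A poset whose underlying set is a subset of T. The values of sp_le outside
   sp_carrier are irrelevant: every notion below only looks at its restriction
   to the carrier. *)
Record subposet (T : Type) := SubPoset {
  sp_carrier :> set T;
  sp_le : T -> T -> Prop;
  sp_refl : forall x, sp_carrier x -> sp_le x x;
  sp_anti : forall x y, sp_carrier x -> sp_carrier y ->
    sp_le x y -> sp_le y x -> x = y;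
  sp_trans : forall y x z, sp_carrier x -> sp_carrier y -> sp_carrier z ->
    sp_le x y -> sp_le y z -> sp_le x z
}.

Identity Coercion set_to_fun : set >-> Funclass.

Definition is_subposet (T : Type) (P Q : subposet T) :=
  P `<=` Q /\ forall x y, P x -> P y -> (sp_le P x y <-> sp_le Q x y).

HB.mixin Record isLocallyOrdered T & Topological T := {
  ordered_base : set (subposet T);
  ordered_base_basis : basis [set sp_carrier B | B in ordered_base];
  ordered_base_join : forall (B B' : subposet T) (x : T),
    ordered_base B -> ordered_base B' -> B x -> B' x ->
    exists B'' : subposet T,
      [/\ ordered_base B'', B'' x, is_subposet B'' B & is_subposet B'' B']
}.

#[short(type="locallyOrderedType")]
HB.structure Definition LocallyOrdered :=
  {T of Topological T & isLocallyOrdered T}.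

(* Open subsets of members of the ordered base, with the induced order, are
   also ordered open sets. *)
Definition ordered_open (X : locallyOrderedType) (U : subposet X) :=
  open (U : set X) /\ exists2 B, ordered_base B & is_subposet U B.

Definition ordered_nbhd (X : locallyOrderedType) (x : X) (U : subposet X) :=
  ordered_open U /\ U x.

Definition order_preserving_on (X Y : Type) (A : set X)
    (leX : X -> X -> Prop) (leY : Y -> Y -> Prop) (f : X -> Y) :=
  forall a b, A a -> A b -> leX a b -> leY (f a) (f b).

Definition lo_morphism (X Y : locallyOrderedType) (f : X -> Y) :=
  continuous f /\
  forall x (V : subposet Y), ordered_nbhd (f x) V ->
    exists U : subposet X, [/\ ordered_nbhd x U, f @` U `<=` V
      & order_preserving_on U (sp_le U) (sp_le V) f].

(* The inverse g of f on f @` U is represented by a total function on Y, of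
   which only the restriction to f @` U matters. *)
Definition local_embedding (X Y : locallyOrderedType) (f : X -> Y) :=
  continuous f /\
  forall x (V : subposet Y), ordered_nbhd (f x) V ->
    exists U : subposet X, [/\ ordered_nbhd x U, f @` U `<=` V,
      order_preserving_on U (sp_le U) (sp_le V) f
      & exists g : Y -> X, [/\ forall a, U a -> g (f a) = a,
          {within f @` U, continuous g}
          & order_preserving_on (f @` U) (sp_le V) (sp_le U) g]].

Definition lo_isomorphic (X Y : locallyOrderedType) :=
  exists (f : X -> Y) (g : Y -> X),
    [/\ cancel f g, cancel g f, lo_morphism f & lo_morphism g].

Definition dihomeomorphic (S T : topologicalType)
    (leS : S -> S -> Prop) (leT : T -> T -> Prop) :=
  exists (f : S -> T) (g : T -> S),
    [/\ cancel f g, cancel g f, continuous f, continuous g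
      & forall x y, leS x y <-> leT (f x) (f y)].

Definition rV_le (R : realType) (n : nat) (u v : 'rV[R]_n) :=
  forall i, u 0 i <= v 0 i.

Definition euclidean (R : realType) (n : nat) (E : locallyOrderedType) :=
  forall x : E, exists2 U : subposet E, ordered_nbhd x U
    & dihomeomorphic (fun a b : U => sp_le U (val a) (val b)) (@rV_le R n).

Lemma is_subposet_refl (T : Type) (P : subposet T) : is_subposet P P.
Proof. by split. Qed.

Lemma is_subposet_trans (T : Type) (P Q S : subposet T) :
  is_subposet P Q -> is_subposet Q S -> is_subposet P S.
Proof.
move=> [PQ lePQ] [QS leQS]; split=> [|x y Px Py]; first exact: subset_trans QS.
by rewrite lePQ // leQS//; exact: PQ.
Qed.

Program Definition sp_restrict (T : Type) (P : subposet T) (A : set T) :=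
  {| sp_carrier := P `&` A; sp_le := sp_le P |}.
Next Obligation. by move=> T P A x [Px _]; exact: sp_refl. Qed.
Next Obligation. by move=> T P A x y [Px _] [Py _]; exact: sp_anti. Qed.
Next Obligation. by move=> T P A y x z [? _] [? _] [? _]; exact: sp_trans. Qed.

Lemma is_subposet_restrict (T : Type) (P : subposet T) (A : set T) :
  is_subposet (sp_restrict P A) P.
Proof. by split=> // x []. Qed.

Section ordered_open_theory.
Context {X : locallyOrderedType}.
Implicit Types (U V B : subposet X) (x : X).

Lemma ordered_base_open B : ordered_base B -> open (B : set X).
Proof. by move=> oB; apply: (@ordered_base_basis X).1; exists B. Qed.

Lemma ordered_base_nbhs x (W : set X) : nbhs x W ->
  exists B, [/\ ordered_base B, B x & B `<=` W].
Proof.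
by move/(@ordered_base_basis X).2 => [_ [[B oB <-] Bx] BW]; exists B.
Qed.

Lemma ordered_open_base B : ordered_base B -> ordered_open B.
Proof.
move=> oB; split; first exact: ordered_base_open.
by exists B => //; exact: is_subposet_refl.
Qed.

Lemma ordered_open_restrict U (W : set X) :
  ordered_open U -> open W -> ordered_open (sp_restrict U W).
Proof.
move=> [oU [B bB UB]] oW; split; first exact: openI.
by exists B => //; exact: is_subposet_trans (is_subposet_restrict U W) UB.
Qed.

Lemma ordered_nbhd_restrict U (W : set X) x :
  ordered_nbhd x U -> open W -> W x -> ordered_nbhd x (sp_restrict U W).
Proof. by move=> [oU Ux] oW Wx; split=> //; exact: ordered_open_restrict. Qed.

Lemma ordered_nbhd_join U V x : ordered_nbhd x U -> ordered_nbhd x V ->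
  exists S, [/\ ordered_nbhd x S, is_subposet S U & is_subposet S V].
Proof.
move=> [[oU [B bB UB]] Ux] [[oV [C bC VC]] Vx].
have [D [bD Dx DB DC]] := ordered_base_join _ _ _ bB bC (UB.1 x Ux) (VC.1 x Vx).
exists (sp_restrict D (U `&` V)); split.
- by apply: ordered_nbhd_restrict => //; [split=> //; exact: ordered_open_base
    |exact: openI].
- split=> [y [_ []]//|y z [Dy [Uy _]] [Dz [Uz _]]].
  by rewrite /= DB.2 // UB.2.
- split=> [y [_ []]//|y z [Dy [_ Vy]] [Dz [_ Vz]]].
  by rewrite /= DC.2 // VC.2.
Qed.

Lemma ordered_nbhd_sub x (W : set X) : nbhs x W ->
  exists U, ordered_nbhd x U /\ U `<=` W.
Proof.
move/ordered_base_nbhs => [B [bB Bx BW]]; exists B; split=> //.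
by split=> //; exact: ordered_open_base.
Qed.

End ordered_open_theory.

Section trace.
Context {X : locallyOrderedType} (A : set X).

Program Definition sp_trace (B : subposet X) : subposet A := {|
  sp_carrier := set_val @^-1` B;
  sp_le := fun x y => sp_le B (val x) (val y) |}.
Next Obligation. by move=> B x Bx; exact: sp_refl. Qed.
Next Obligation.
by move=> B x y Bx By xy yx; apply: val_inj; exact: (sp_anti Bx By).
Qed.
Next Obligation. by move=> B y x z Bx By Bz; exact: sp_trans. Qed.

Definition trace_base : set (subposet A) :=
  [set sp_trace B | B in ordered_base].

Lemma val_continuous : continuous (set_val : A -> X).
Proof. exact: (@initial_continuous _ _ (set_val : A -> X)). Qed.

Lemma is_subposet_trace (B C : subposet X) :
  is_subposet B C -> is_subposet (sp_trace B) (sp_trace C).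
Proof. by move=> [BC leBC]; split=> [x /BC//|x y Bx By]; exact: leBC. Qed.

Lemma open_trace (W : set X) : open W -> open (set_val @^-1` W : set A).
Proof. by move=> oW; have /continuousP := val_continuous; apply. Qed.

Lemma nbhs_trace (x : A) (W : set A) : nbhs x W ->
  exists2 V : set X, nbhs (val x) V & set_val @^-1` V `<=` W.
Proof.
rewrite nbhsE => -[O [[V oV <-] Vx OW]]; exists V => //.
by rewrite nbhsE; exists V.
Qed.

Lemma trace_basis : basis [set sp_carrier B | B in trace_base].
Proof.
split=> [_ [_ [B bB <-] <-]|x W /nbhs_trace[V Vx VW]].
  by apply: open_trace; exact: ordered_base_open.
have [B [bB Bx BV]] := ordered_base_nbhs Vx.
exists (set_val @^-1` B); last by move=> y /BV/VW.
by split=> //; exists (sp_trace B) => //; exists B.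
Qed.

Lemma trace_join (B B' : subposet A) (x : A) :
  trace_base B -> trace_base B' -> B x -> B' x ->
  exists B'' : subposet A,
    [/\ trace_base B'', B'' x, is_subposet B'' B & is_subposet B'' B'].
Proof.
move=> [C bC <-] [D bD <-] Cx Dx.
have [E [bE Ex EC ED]] := ordered_base_join _ _ _ bC bD Cx Dx.
by exists (sp_trace E); split; [exists E|..|exact: is_subposet_trace
  |exact: is_subposet_trace].
Qed.

HB.instance Definition _ := isLocallyOrdered.Build (set_type A)
  trace_basis trace_join.

Lemma ordered_nbhd_trace (x : A) (V : subposet X) :
  ordered_nbhd (val x) V -> ordered_nbhd x (sp_trace V).
Proof.
move=> [[oV [B bB VB]] Vx]; split=> //; split; first exact: open_trace.
by exists (sp_trace B); [exists B|exact: is_subposet_trace].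
Qed.

Lemma ordered_nbhd_of_trace (x : A) (U : subposet A) : ordered_nbhd x U ->
  exists V, ordered_nbhd (val x) V /\ is_subposet (sp_trace V) U.
Proof.
move=> [[oU [_ [B bB <-] UB]] Ux].
have [W Wx WU] : exists2 W, nbhs (val x) W & set_val @^-1` W `<=` U.
  by apply: nbhs_trace; rewrite nbhsE; exists U.
move: Wx; rewrite nbhsE => -[O [oO Ox] OW].
exists (sp_restrict B O); split.
  apply: ordered_nbhd_restrict => //; split; first exact: ordered_open_base.
  exact: UB.1 Ux.
have sU : set_val @^-1` (B `&` O) `<=` U by move=> y [_ /OW/WU].
by split=> // y z By Bz; rewrite UB.2//; exact: sU.
Qed.

Lemma lo_morphism_val : lo_morphism (set_val : A -> X).
Proof.
split; first exact: val_continuous.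
move=> x V xV; exists (sp_trace V).
by split; [exact: ordered_nbhd_trace|move=> _ [y Vy <-]|].
Qed.

Lemma lo_morphism_lift (S : locallyOrderedType) (f : S -> A) :
  lo_morphism (set_val \o f) -> lo_morphism f.
Proof.
move=> [cf f_mono]; split=> [|x V].
  apply/continuousP => _ [W oW <-].
  by move/continuousP : cf; exact.
move=> /ordered_nbhd_of_trace[W [xW [WV leWV]]].
have [U [xU UW Umono]] := f_mono _ _ xW.
have fU a : U a -> sp_trace W (f a) by move=> Ua; apply: UW; exists a.
exists U; split=> // [_ [y Uy <-]|a b Ua Ub ab].
  by apply: WV; exact: fU.
by apply/leWV; [exact: fU..|exact: Umono].
Qed.

End trace.

Lemma lo_morphism_comp (X Y Z : locallyOrderedType) (f : X -> Y) (g : Y -> Z) :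
  lo_morphism f -> lo_morphism g -> lo_morphism (g \o f).
Proof.
move=> [cf mf] [cg mg]; split=> [x|x V xV].
  by apply: continuous_comp; [exact: cf|exact: cg].
have [U [xU UV Um]] := mg _ _ xV; have [W [xW WU Wm]] := mf _ _ xU.
have fW a : W a -> U (f a) by move=> Wa; apply: WU; exists a.
exists W; split=> // [_ [y Wy <-]|a b Wa Wb ab].
  by apply: UV; exists (f y) => //; exact: fW.
by apply: Um; [exact: fW..|exact: Wm].
Qed.

Section squash.
Context {R : realType}.
Implicit Types x y : R.

Definition squash x := x / (1 + `|x|).
Definition unsquash x := x / (1 - `|x|).

Lemma squash_lt1 x : `|squash x| < 1.
Proof.
have x0 : 0 < 1 + `|x| by rewrite ltr_pwDl.
by rewrite /squash normrM normfV (gtr0_norm x0) ltr_pdivrMr// mul1r ltrDr.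
Qed.

Lemma squashK : cancel squash unsquash.
Proof.
move=> x; have x0 : 0 < 1 + `|x| by rewrite ltr_pwDl.
rewrite /unsquash {2}/squash normrM normfV (gtr0_norm x0) /squash.
by have := x0; move: `|x| => a a0; field; rewrite addrK oner_eq0/= gt_eqF.
Qed.

Lemma unsquashK x : `|x| < 1 -> squash (unsquash x) = x.
Proof.
move=> x1; have x0 : 0 < 1 - `|x| by rewrite subr_gt0.
rewrite /squash {2}/unsquash normrM normfV (gtr0_norm x0) /unsquash.
by move: `|x| x0 => a a0; field; rewrite subrK oner_eq0/= gt_eqF.
Qed.

Lemma squash_mono : {mono squash : x y / x <= y}.
Proof.
apply/le_mono/inj_homo_lt; first exact: can_inj squashK.
move=> x y xy; rewrite /squash.
rewrite ler_pdivrMr ?ltr_pwDl// mulrAC ler_pdivlMr ?ltr_pwDl//.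
have := normr_ge0 x; have := normr_ge0 y.
by case: (leP 0 x) => x0; case: (leP 0 y) => y0;
  rewrite ?(ger0_norm x0) ?(ltr0_norm x0) ?(ger0_norm y0) ?(ltr0_norm y0); nra.
Qed.

Lemma continuous_squash : continuous squash.
Proof.
move=> x; have x0 : 0 < 1 + `|x| by rewrite ltr_pwDl.
apply: cvgM; first exact: cvg_id.
apply: cvgV; first by rewrite gt_eqF.
by apply: cvgD; [exact: cvg_cst|apply: cvg_norm; exact: cvg_id].
Qed.

Lemma continuous_unsquash x : `|x| < 1 -> {for x, continuous unsquash}.
Proof.
move=> x1; have x0 : 0 < 1 - `|x| by rewrite subr_gt0.
apply: cvgM; first exact: cvg_id.
apply: cvgV; first by rewrite gt_eqF.
by apply: cvgB; [exact: cvg_cst|apply: cvg_norm; exact: cvg_id].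
Qed.

End squash.

Section box.
Context {R : realType} {n : nat} (c : 'rV[R]_n) (e : R).
Hypothesis e0 : 0 < e.
Implicit Types r : 'rV[R]_n.

Definition box : set 'rV[R]_n := [set r | forall i, `|r 0 i - c 0 i| < e].

Definition to_box r : 'rV[R]_n := \row_i (c 0 i + e * squash (r 0 i)).

Definition of_box r : 'rV[R]_n := \row_i unsquash ((r 0 i - c 0 i) / e).

Lemma rV_continuous_at (T : topologicalType) (F : T -> 'rV[R]_n) (t : T) :
  (forall i, {for t, continuous (fun s => F s 0 i)}) -> {for t, continuous F}.
Proof.
move=> cF A [P FP PA].
have : \forall s \near t, forall i, P 0 i (F s 0 i).
  by apply: filter_forall => i; apply: cF; exact: FP.
by apply: filterS => s Ps; apply: PA => i j; rewrite ord1; exact: Ps.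
Qed.

Lemma to_box_in r : box (to_box r).
Proof.
move=> i; rewrite mxE addrC addKr normrM (gtr0_norm e0).
by rewrite -[ltRHS]mulr1 ltr_pM2l// squash_lt1.
Qed.

Lemma to_boxK : cancel to_box of_box.
Proof.
move=> r; apply/rowP => i; rewrite !mxE addrC addKr mulrAC divff ?gt_eqF//.
by rewrite mul1r squashK.
Qed.

Local Lemma box_lt1 r i : box r -> `|(r 0 i - c 0 i) / e| < 1.
Proof.
by move=> br; rewrite normrM normfV (gtr0_norm e0) ltr_pdivrMr// mul1r.
Qed.

Lemma of_boxK r : box r -> to_box (of_box r) = r.
Proof.
move=> br; apply/rowP => i; rewrite !mxE unsquashK; last exact: box_lt1.
by rewrite mulrC divfK ?gt_eqF// addrC subrK.
Qed.

Lemma to_box_le r s : rV_le (to_box r) (to_box s) <-> rV_le r s.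
Proof.
by split=> rs i; have := rs i; rewrite !mxE lerD2l ler_pM2l// squash_mono.
Qed.

Lemma of_box_le r s : box r -> box s ->
  rV_le (of_box r) (of_box s) <-> rV_le r s.
Proof. by move=> br bs; rewrite -to_box_le !of_boxK. Qed.

Lemma continuous_to_box : continuous to_box.
Proof.
move=> r; apply: rV_continuous_at => i.
rewrite (_ : (fun s => to_box s 0 i) =
  (fun s => c 0 i + e * squash (s 0 i))); last first.
  by apply/funext => s; rewrite mxE.
apply: (@continuous_comp _ _ _ (fun s : 'rV[R]_n => s 0 i)
  (fun y => c 0 i + e * squash y)); first exact: coord_continuous.
apply: cvgD; first exact: cvg_cst.
by apply: cvgM; [exact: cvg_cst|exact: continuous_squash].
Qed.

Lemma continuous_of_box r : box r -> {for r, continuous of_box}.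
Proof.
move=> br; apply: rV_continuous_at => i.
rewrite (_ : (fun s => of_box s 0 i) =
  (fun s => unsquash ((s 0 i - c 0 i) / e))); last first.
  by apply/funext => s; rewrite mxE.
apply: (@continuous_comp _ _ _ (fun s : 'rV[R]_n => s 0 i)
  (fun y => unsquash ((y - c 0 i) / e))); first exact: coord_continuous.
apply: (@continuous_comp _ _ _ (fun y => (y - c 0 i) / e)).
  apply: cvgM; last exact: cvg_cst.
  by apply: cvgB; [exact: cvg_id|exact: cvg_cst].
exact/continuous_unsquash/box_lt1.
Qed.

Lemma box_center : box c.
Proof. by move=> i; rewrite subrr normr0. Qed.

Lemma open_box : open box.
Proof.
have nb r : box r -> nbhs r [set s : 'rV[R]_n | forall i, `|s 0 i - c 0 i| < e].
  move=> br; apply: (@filter_forall _ _ (fun i (s : 'rV[R]_n) =>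
    `|s 0 i - c 0 i| < e) _ (nbhs_filter r)) => i.
  have cf : {for r, continuous (fun s : 'rV[R]_n => `|s 0 i - c 0 i|)}.
    apply: (@continuous_comp _ _ _ (fun s : 'rV[R]_n => s 0 i)
      (fun y => `|y - c 0 i|)); first exact: coord_continuous.
    by apply: cvg_norm; apply: cvgB; [exact: cvg_id|exact: cvg_cst].
  exact: (cf [set y | y < e] (lt_nbhsl (br i))).
by rewrite openE => r /nb.
Qed.

End box.

Lemma nbhs_box (R : realType) n (c : 'rV[R]_n) (W : set 'rV[R]_n) :
  nbhs c W -> exists2 e, 0 < e & box c e `<=` W.
Proof.
move=> /nbhs_ballP[e /= e0 eW]; exists e => // r br; apply: eW.
by split=> // i j; rewrite ord1 /ball/= distrC.
Qed.

Lemma continuous_lift (S T : topologicalType) (A : set T) (f : S -> A) :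
  continuous (set_val \o f) -> continuous f.
Proof.
by move=> cf; apply/continuousP => _ [W oW <-]; move/continuousP : cf; exact.
Qed.

Lemma euclidean_open (R : realType) n (E : locallyOrderedType) (D : set E) :
  euclidean R n E -> open D -> euclidean R n (set_type D).
Proof.
move=> Eeu oD d.
have [U dU [h [k [hK kK ch ck hle]]]] := Eeu (val d).
pose u0 : U := exist _ (val d) (mem_set dU.2).
have [e e0 boxP] : exists2 e, 0 < e & box (h u0) e `<=` (set_val \o k) @^-1` D.
  apply: (@nbhs_box R n); apply: open_nbhs_nbhs; split=> /=; last first.
    by rewrite hK; exact: (set_valP d).
  have /continuousP : continuous (set_val \o k).
    by move=> r; apply: continuous_comp; [exact: ck|exact: val_continuous].
  exact.
have [O oO Obox] : open (h @^-1` box (h u0) e).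
  by move/continuousP : ch; apply; exact: open_box.
have OboxP (u : U) : O (val u) <-> box (h u0) e (h u).
  by rewrite -[_ (h u)]/((h @^-1` box (h u0) e) u) -Obox.
have dO : O (val d) by apply/(OboxP u0); exact: box_center.
have dV := ordered_nbhd_trace (ordered_nbhd_restrict dU oO dO).
set V := sp_trace _ _ in dV; exists V => //.
have VU (v : V) : val (val v) \in (U : set E).
  by apply/mem_set; have [] := set_valP v.
pose toU (v : V) : U := exist _ (val (val v)) (VU v).
have toUbox v : box (h u0) e (h (toU v)) by apply/OboxP; have [] := set_valP v.
have c_toU : continuous toU.
  apply: continuous_lift => v; apply: (@continuous_comp _ _ _ set_val set_val);
  exact: val_continuous.
pose y r := k (to_box (h u0) e r).
have yD r : val (y r) \in D by apply/mem_set/boxP; exact: to_box_in.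
pose yd r : D := exist (fun x => x \in D) _ (yD r).
have yV r : yd r \in (V : set D).
  apply/mem_set; split; first exact: (set_valP (y r)).
  by apply/OboxP; rewrite kK; exact: to_box_in.
exists (fun v => of_box (h u0) e (h (toU v))),
  (fun r => exist (fun x => x \in (V : set D)) (yd r) (yV r)).
split.
- move=> v; apply/val_inj/val_inj => /=; rewrite /y of_boxK//.
  by rewrite hK.
- move=> r; rewrite (_ : toU _ = y r); last exact: val_inj.
  by rewrite kK to_boxK.
- move=> v; apply: (@continuous_comp _ _ _ (h \o toU)); last first.
    by apply: continuous_of_box => //; exact: toUbox.
  by apply: continuous_comp; [exact: c_toU|exact: ch].
- do 2![apply: continuous_lift].
  move=> r; apply: (@continuous_comp _ _ _ y set_val).
    by apply: continuous_comp; [exact: continuous_to_box|exact: ck].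
  exact: val_continuous.
- by move=> v w; rewrite of_box_le// -hle.
Qed.

Section sections.
Context (R : realType) (n : nat) (X : locallyOrderedType).
Implicit Types (x y : X) (A U V : set X).

Definition sections U : set (set X) :=
  [set A | A `<=` U /\
    exists2 E : locallyOrderedType,
      euclidean R n E & lo_isomorphic (set_type A) E].

Lemma sections_restrict U V A :
  sections V A -> open U -> U `<=` V -> sections U (A `&` U).
Proof.
move=> [AV [E Eeu [f [g [fK gK mf mg]]]]] oU UV; split; first by move=> x [].
pose D : set E := g @^-1` (set_val @^-1` U).
have oD : open D.
  by have /continuousP := mg.1; apply; exact: open_trace.
exists (set_type D); first exact: euclidean_open.
have AU (a : set_type (A `&` U)) : val a \in A.
  by apply/mem_set; have [] := set_valP a.
pose toA (a : set_type (A `&` U)) : A := exist (fun x => x \in A) _ (AU a).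
have fD a : f (toA a) \in D.
  by apply/mem_set; rewrite /D /= fK; have [] := set_valP a.
have gAU (d : D) : val (g (val d)) \in A `&` U.
  by apply/mem_set; split; [exact: (set_valP (g (val d)))|exact: (set_valP d)].
exists (fun a => exist (fun z : E => z \in D) _ (fD a)),
  (fun d => exist (fun z : X => z \in A `&` U) _ (gAU d)); split.
- by move=> a; apply: val_inj; rewrite /= fK.
- move=> d; apply: val_inj => /=.
  by rewrite (_ : toA _ = g (val d)) ?gK//; exact: val_inj.
- apply: lo_morphism_lift; apply: (@lo_morphism_comp _ _ _ toA f) => //.
  by apply: lo_morphism_lift; exact: lo_morphism_val.
- apply: lo_morphism_lift;
  apply: (@lo_morphism_comp _ _ _ (g \o set_val) set_val).
    by apply: lo_morphism_comp => //; exact: lo_morphism_val.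
  exact: lo_morphism_val.
Qed.

(* Restriction maps being intersections, sections A over V and A' over V' have
   the same image in the colimit at x iff they have the same germ at x as
   subsets of X. A germ is represented by its class of subsets. *)
Definition germ_eq x A A' := exists2 W, nbhs x W & A `&` W = A' `&` W.

Definition germ x A : set (set X) := [set A' | germ_eq x A A'].

Definition stalk x : set (set (set X)) :=
  [set germ x A | A in
    [set A | exists V : set X, [/\ open V, V x & sections V A]]].

Record germ_bundle := GermBundle {
  germ_pt : X;
  germ_val : set (set X);
  germ_valP : stalk germ_pt germ_val
}.

HB.instance Definition _ := gen_eqMixin germ_bundle.
HB.instance Definition _ := gen_choiceMixin germ_bundle.

End sections.

Section germ_bundle.
Context {R : realType} {n : nat} {X : locallyOrderedType}.
Local Notation bundle := (germ_bundle R n X).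
Implicit Types (x y : X) (A : set X) (U V : subposet X) (g : bundle).

Lemma germ_eq_refl x A : germ_eq x A A.
Proof. by exists setT => //; exact: filterT. Qed.

Lemma germ_eq_sym x A A' : germ_eq x A A' -> germ_eq x A' A.
Proof. by move=> [W xW AA']; exists W. Qed.

Lemma germ_eq_trans x A B C : germ_eq x A B -> germ_eq x B C -> germ_eq x A C.
Proof.
move=> [V xV AB] [W xW BC]; exists (V `&` W); first exact: filterI.
by rewrite setIA AB setIAC BC setIAC -setIA.
Qed.

Lemma germE x A A' : germ x A = germ x A' <-> germ_eq x A A'.
Proof.
split=> [AA'|AA'].
  by rewrite -[germ_eq _ _ _]/(germ x A A') AA'; exact: germ_eq_refl.
apply/seteqP; split=> B; first exact/germ_eq_trans/germ_eq_sym.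
exact: germ_eq_trans.
Qed.

Lemma germ_bundle_eq g g' :
  germ_pt g = germ_pt g' -> germ_val g = germ_val g' -> g = g'.
Proof.
case: g g' => [x a xa] [y b yb] /= xy ab; move: xa yb.
by rewrite xy ab => xa yb; rewrite (Prop_irrelevance xa yb).
Qed.

(* The set U^+_A of the germs A_y for y in U, ordered as U through y: the base
   point y is determined by the germ. *)
Program Definition sp_germs U A : subposet bundle := {|
  sp_carrier := [set g | U (germ_pt g) /\ germ_val g = germ (germ_pt g) A];
  sp_le := fun g g' => sp_le U (germ_pt g) (germ_pt g') |}.
Next Obligation. by move=> U A g [Ug _]; exact: sp_refl. Qed.
Next Obligation.
move=> U A g g' [Ug gA] [Ug' g'A] gg' g'g.
have pE := sp_anti Ug Ug' gg' g'g.
by apply: germ_bundle_eq => //; rewrite gA g'A pE.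
Qed.
Next Obligation. by move=> U A h g k [Ug _] [Uh _] [Uk _]; exact: sp_trans. Qed.

Definition germ_base : set (subposet bundle) :=
  [set B | exists U A,
    [/\ ordered_open U, sections R n U A & B = sp_germs U A]].

Lemma germ_base_cover g : exists2 B, germ_base B & B g.
Proof.
have [A [V [oV Vg VA]] gA] := germ_valP g.
have [U [[oU Ug] UV]] := ordered_nbhd_sub (open_nbhs_nbhs (conj oV Vg)).
exists (sp_germs U (A `&` U)).
  exists U, (A `&` U); split=> //; apply: sections_restrict VA _ UV.
  by case: oU.
split=> //; rewrite -gA; apply/germE; exists U; last by rewrite -setIA setIid.
by apply: open_nbhs_nbhs; split=> //; case: oU.
Qed.

Lemma germ_base_join (B B' : subposet bundle) g :
  germ_base B -> germ_base B' -> B g -> B' g ->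
  exists B'' : subposet bundle,
    [/\ germ_base B'', B'' g, is_subposet B'' B & is_subposet B'' B'].
Proof.
move=> [U [A [oU UA ->]]] [V [C [oV VC ->]]] [Ug gA] [Vg gC].
have [W gW AC] : germ_eq (germ_pt g) A C by apply/germE; rewrite -gA -gC.
have [S [[oS Sg] SU SV]] := ordered_nbhd_join (conj oU Ug) (conj oV Vg).
move: gW; rewrite nbhsE => -[O [oO Og] OW].
pose T := sp_restrict S O; pose D := A `&` T.
have oT : ordered_open T by exact: ordered_open_restrict.
have nbT h : T (germ_pt h) -> nbhs (germ_pt h) T.
  by move=> Th; apply: open_nbhs_nbhs; split=> //; case: oT.
have DA h : T (germ_pt h) -> germ (germ_pt h) D = germ (germ_pt h) A.
  move=> Th; apply/germE; exists T; first exact: nbT.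
  by rewrite -setIA setIid.
have DC h : T (germ_pt h) -> germ (germ_pt h) D = germ (germ_pt h) C.
  move=> Th; rewrite DA//; apply/germE; exists T; first exact: nbT.
  have TW : T `<=` W by move=> z [_ /OW].
  by rewrite -(setIidr TW) !setIA AC.
exists (sp_germs T D); split.
- exists T, D; split=> //; apply: sections_restrict UA _ _; first by case: oT.
  by move=> z [Sz _]; exact: SU.1.
- by split=> //; rewrite gA DA.
- split=> [h [Th hD]|h k [[Sh _] _] [[Sk _] _]]; last exact: SU.2.
  by split; [exact: SU.1 Th.1|rewrite hD DA].
- split=> [h [Th hD]|h k [[Sh _] _] [[Sk _] _]]; last exact: SV.2.
  by split; [exact: SV.1 Th.1|rewrite hD DC].
Qed.

Definition germ_open : set (set bundle) :=
  [set W | forall g, W g -> exists B, [/\ germ_base B, B g & B `<=` W]].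

Let germ_openT : germ_open setT.
Proof. by move=> g _; have [B bB Bg] := germ_base_cover g; exists B. Qed.

Let germ_openI : setI_closed germ_open.
Proof.
move=> V W oV oW g [/oV[B [bB Bg BV]] /oW[C [bC Cg CW]]].
have [D [bD Dg [DB _] [DC _]]] := germ_base_join bB bC Bg Cg.
by exists D; split=> // h Dh; split; [exact/BV/DB|exact/CW/DC].
Qed.

Let germ_open_bigU (I : Type) (f : I -> set bundle) :
  (forall i, germ_open (f i)) -> germ_open (\bigcup_i f i).
Proof.
move=> fo g [i _ /fo[B [bB Bg Bf]]]; exists B; split=> // h /Bf fh.
by exists i.
Qed.

HB.instance Definition _ :=
  isOpenTopological.Build bundle germ_openT germ_openI germ_open_bigU.

Lemma germ_openE : @open bundle = germ_open.
Proof. by []. Qed.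

Lemma germ_base_basis : basis [set sp_carrier B | B in germ_base].
Proof.
split=> [_ [B bB <-]|g W]; first by rewrite germ_openE => g Bg; exists B; split.
rewrite nbhsE => -[O []]; rewrite germ_openE => oO Og OW.
have [B [bB Bg BO]] := oO _ Og.
exists B; first by split=> //; exists B.
exact: (subset_trans BO OW).
Qed.

HB.instance Definition _ :=
  isLocallyOrdered.Build bundle germ_base_basis germ_base_join.

End germ_bundle.

Section blowup.
Context (R : realType) (n : nat) (X : locallyOrderedType).

Definition blowup_set : set (germ_bundle R n X) :=
  [set g | exists V A, [/\ open V, V (germ_pt g), sections R n V A,
    germ_val g = germ (germ_pt g) A & A (germ_pt g)]].

Definition blowup : Type := set_type blowup_set.

HB.instance Definition _ := LocallyOrdered.on blowup.

Definition blowup_map (g : blowup) : X := germ_pt (val g).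

End blowup.

(* Main.v *)
Require Import Defs.
From mathcomp Require Import all_boot all_order all_algebra.
From mathcomp Require Import all_classical all_reals.
From mathcomp Require Import topology normedtype.
From mathcomp Require Import lra.

Set Implicit Arguments.
Unset Strict Implicit.
Unset Printing Implicit Defensive.

Import Order.TTheory GRing.Theory Num.Theory.
Import numFieldNormedType.Exports.

Local Open Scope classical_set_scope.
Local Open Scope ring_scope.

(** Near a point e, a local embedding f identifies an open set U of E with its
image f(U), which is therefore an n-euclidean subset of X passing through f(e).
Two such open sets overlap in a third one, whose image is open in both images,
so the germ of f(U) at f(e) depends on e alone. Sending e to this germ is the
lift. It is continuous because the same U serves all points of U, and it is a
local embedding because the order on the blowup is read on base points, so that
the local inverses of f, precomposed with the blowup map, invert the lift.

Uniqueness is the part with geometric content. A continuous lift of f picks at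
e the germ of some euclidean A; by continuity it still picks the germ of A at
nearby points, and as germs in the blowup pass through their base point, f maps
a neighborhood D of e into A. Both D and A are n-dimensional, and one needs
f(D) to be a neighborhood of f(e) in A, so that A and f(U) have the same germ.
Without the order this would be invariance of domain. With it, there is an
elementary argument, [order_embedding_open]: a continuous order embedding F of
R^n into itself permutes the coordinates and is otherwise a product of n
increasing functions, so that the intermediate value theorem applies to each of
them. The permutation comes from the pigeonhole argument which shows that the
standard example of a poset of order dimension n does not embed in R^(n-1):
for each i take p_i not below q_i with p_i below q_j for j <> i; some
coordinate separates F(p_i) from F(q_i), and no coordinate can do it for two
distinct i. *)

(** * Order embeddings of R^n into itself *)

Section order_embedding.
Context (R : realType) (n : nat).
Implicit Types (i j k : 'I_n) (x y : 'rV[R]_n) (t : R).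

Definition upd x i t : 'rV[R]_n := \row_j if j == i then t else x 0 j.

Lemma upd_continuous x i : continuous (upd x i).
Proof.
move=> t; apply: rV_continuous_at => j.
rewrite (_ : (fun s => _) = (fun s => if j == i then s else x 0 j)); last first.
  by apply/funext => s; rewrite mxE.
by case: (j == i); [exact: cvg_id|exact: cvg_cst].
Qed.

(** The points [lo_edge i t'] and [hi_edge i t], for t < t', play the roles of
p_i and q_i: each [lo_edge i t'] lies below every [hi_edge j t] with j <> i. *)
Definition lo_edge i t := upd (const_mx (-1)) i t.
Definition hi_edge i t := upd (const_mx 1) i t.

Definition unit_cube x := forall i, -1 <= x 0 i <= 1.

Lemma lo_edge_le x i : unit_cube x -> rV_le (lo_edge i (x 0 i)) x.
Proof.
by move=> xQ j; rewrite !mxE; case: eqP => [->//|_]; have /andP[] := xQ j.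
Qed.

Lemma hi_edge_ge x i : unit_cube x -> rV_le x (hi_edge i (x 0 i)).
Proof.
by move=> xQ j; rewrite !mxE; case: eqP => [->//|_]; have /andP[] := xQ j.
Qed.

Context (F : 'rV[R]_n -> 'rV[R]_n).
Hypothesis F_le : forall x y, rV_le x y <-> rV_le (F x) (F y).

(** All pairs t < t' are allowed at once: [separates_inj] then compares
witnesses for different values of t and t', so that the coordinate separating
the i-th pair is independent of them. *)
Definition separates i k := exists t t',
  [/\ -1 <= t, t < t', t' <= 1 & F (hi_edge i t) 0 k < F (lo_edge i t') 0 k].

Lemma separates_exists i t t' : -1 <= t -> t < t' -> t' <= 1 ->
  exists2 k, separates i k & F (hi_edge i t) 0 k < F (lo_edge i t') 0 k.
Proof.
move=> t1 tt' t'1.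
have : ~ rV_le (F (lo_edge i t')) (F (hi_edge i t)).
  by move=> /(F_le _ _).2/(_ i); rewrite !mxE eqxx leNgt tt'.
move=> /existsNP[k /negP]; rewrite -ltNge => tk.
by exists k => //; exists t, t'.
Qed.

(** If k separated both pairs, then, p_i being below q_j and p_j below q_i, the
k-th coordinates would satisfy F q_i < F p_i <= F q_j < F p_j <= F q_i. *)
Lemma separates_inj i j k : separates i k -> separates j k -> i = j.
Proof.
move=> [t [t' [t1 tt' t'1 Ft]]] [s [s' [s1 ss' s'1 Fs]]].
apply: contrapT => ij.
have lohi a b u v : a != b -> -1 <= u -> v <= 1 ->
    F (lo_edge a v) 0 k <= F (hi_edge b u) 0 k.
  move=> ab u1 v1.
  have /(F_le _ _).1 : rV_le (lo_edge a v) (hi_edge b u); last exact.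
  by move=> l; rewrite !mxE; case: eqP => [->|_]; rewrite ?(negbTE ab)//;
    case: eqP => // _; lra.
have := lohi _ _ _ _ (introN eqP ij) s1 t'1.
have := lohi _ _ _ _ (introN eqP (nesym ij)) t1 s'1.
lra.
Qed.

(** The sets of coordinates separating the n pairs are nonempty and pairwise
disjoint in a set with n elements, so they are singletons. *)
Lemma separating_permutation : exists2 p : 'I_n -> 'I_n, bijective p &
  forall i t t', -1 <= t -> t < t' -> t' <= 1 ->
    F (hi_edge i t) 0 (p i) < F (lo_edge i t') 0 (p i).
Proof.
have /choice[p p_sep] i : exists k, separates i k.
  have [|||k ? _] := @separates_exists i (-1) 1; [lra..|by exists k].
have [q pK qK] : bijective p.
  apply: injF_bij => i j pij; apply: separates_inj (p_sep i) _.
  by rewrite pij.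
exists p; first by exists q.
move=> i t t' t1 tt' t'1; have [k ik Fk] := @separates_exists i t t' t1 tt' t'1.
have -> // : p i = k.
rewrite -[RHS]qK; congr p; apply: separates_inj ik _.
by have := p_sep (q k); rewrite qK.
Qed.

Section coordinates.
Variable p : 'I_n -> 'I_n.
Hypothesis F_edges : forall i t t', -1 <= t -> t < t' -> t' <= 1 ->
  F (hi_edge i t) 0 (p i) < F (lo_edge i t') 0 (p i).

(** Among points of the cube with given i-th coordinate, [hi_edge] is the
largest and [lo_edge] the smallest: x and y can be replaced by these extremal
points. *)
Lemma coord_lt x y i : unit_cube x -> unit_cube y -> x 0 i < y 0 i ->
  F x 0 (p i) < F y 0 (p i).
Proof.
move=> xQ yQ xy; have /(F_le _ _).1/(_ (p i)) Fx := hi_edge_ge i xQ.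
have /(F_le _ _).1/(_ (p i)) Fy := lo_edge_le i yQ.
apply: le_lt_trans Fx (lt_le_trans _ Fy).
by apply: F_edges => //; [have /andP[] := xQ i|have /andP[] := yQ i].
Qed.

Hypothesis F_cont : continuous F.

Lemma coord_continuous_line x i k : continuous (fun t => F (upd x i t) 0 k).
Proof.
move=> t; apply: (@continuous_comp _ _ _ (F \o upd x i) (fun y => y 0 k)).
  by apply: continuous_comp; [exact: upd_continuous|exact: F_cont].
exact: coord_continuous.
Qed.

(** Lowering the i-th coordinate of y by an arbitrarily small amount makes
[coord_lt] applicable, and continuity does the rest. By symmetry the [p i]-th
coordinate of F is a function of the i-th coordinate alone. *)
Lemma coord_le_eq x y i : unit_cube x -> unit_cube y -> -1 < x 0 i ->
  x 0 i = y 0 i -> F y 0 (p i) <= F x 0 (p i).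
Proof.
move=> xQ yQ x1 xy; rewrite leNgt; apply/negP => xltFy.
have yE : upd y i (y 0 i) = y.
  by apply/rowP => j; rewrite mxE; case: eqP => // ->.
have /nbhs_ballP[e /= e0 eP] : \forall t \near y 0 i,
    F x 0 (p i) < F (upd y i t) 0 (p i).
  apply: (@coord_continuous_line y i (p i) (y 0 i) [set z | F x 0 (p i) < z]).
  by apply: lt_nbhsr; rewrite yE.
have [t [t1 tx te]] : exists t, [/\ -1 <= t, t < y 0 i & y 0 i - e < t].
  have [h|h] := leP (-1) (y 0 i - e / 2); [exists (y 0 i - e / 2)|exists (-1)];
    split; lra.
have : F x 0 (p i) < F (upd y i t) 0 (p i).
  by apply: eP; rewrite /ball/= gtr0_norm; lra.
apply/negP; rewrite -leNgt; apply/ltW/coord_lt => //.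
  move=> j; rewrite mxE; case: eqP => // _.
  by have := xQ i; lra.
by rewrite mxE eqxx xy.
Qed.

End coordinates.

(** Invariance of domain for order embeddings: a point y close to F 0 is reached
by solving, for each i, the equation in the [p i]-th coordinate along the i-th
axis. *)
Lemma order_embedding_open : continuous F -> nbhs (F 0) (range F).
Proof.
move=> F_cont.
have [p [q pK qK] F_edges] := separating_permutation.
(* Any h in ]0, 1[ would do: [coord_le_eq] needs points off the lower faces. *)
pose h := 2^-1 : R.
have cubeP i t : - h <= t <= h -> unit_cube (upd 0 i t).
  move=> t1 j; rewrite mxE; case: eqP => _; rewrite ?mxE; move: t1;
  by rewrite /h; lra.
have cube0 : unit_cube 0 by move=> j; rewrite mxE; lra.
have coord_nbhs k a b : a < F 0 0 k < b ->
    nbhs (F 0) [set y : 'rV[R]_n | a < y 0 k < b].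
  move=> /andP[ak kb].
  apply: (@coord_continuous _ _ _ 0 k (F 0) [set z | a < z < b]).
  apply: (@filterS _ (nbhs (F 0 0 k)) _ _ _ _
    (filterI (lt_nbhsr ak) (lt_nbhsl kb))) => z [az zb].
  exact/andP.
have : nbhs (F 0) [set y : 'rV[R]_n | forall i,
    F (upd 0 i (- h)) 0 (p i) < y 0 (p i) < F (upd 0 i h) 0 (p i)].
  apply: (@filter_forall _ _ (fun i (y : 'rV[R]_n) =>
    F (upd 0 i (- h)) 0 (p i) < y 0 (p i) < F (upd 0 i h) 0 (p i)) _
    (nbhs_filter (F 0))) => i.
  by apply/coord_nbhs/andP; split; apply: (coord_lt F_edges) => //;
    rewrite ?mxE ?eqxx; try apply: cubeP; rewrite /h; lra.
apply: filterS => y yP.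
have /choice[t tP] i : exists t, - h <= t <= h /\
    F (upd 0 i t) 0 (p i) = y 0 (p i).
  have /andP[y1 y2] := yP i.
  have [|||t] := @IVT _ (fun t => F (upd 0 i t) 0 (p i)) (- h) h (y 0 (p i)).
  - by rewrite /h; lra.
  - by apply: continuous_subspaceT; exact: coord_continuous_line.
  - by rewrite ge_min le_max (ltW y1) (ltW y2) orbT.
  - by rewrite in_itv => ? ?; exists t.
exists (\row_i t i) => //; apply/rowP => k; rewrite -(qK k).
have [tq <-] := tP (q k).
have tQ : unit_cube (\row_i t i).
  by move=> j; rewrite mxE; have [] := tP j; rewrite /h; lra.
by apply/le_anti/andP; split; apply: (coord_le_eq F_edges) => //;
  rewrite ?mxE ?eqxx//; try apply: cubeP => //;
  by move: tq; rewrite /h; lra.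
Qed.

End order_embedding.

(** * Coordinates on euclidean local orders and their sections *)

Section charts.
Context (R : realType) (n : nat).

Lemma to_box0 (c : 'rV[R]_n) (e : R) : to_box c e 0 = c.
Proof. by apply/rowP => i; rewrite !mxE /Defs.squash mul0r mulr0 addr0. Qed.

Lemma ordered_nbhd_nbhs (X : locallyOrderedType) (x : X) (U : subposet X) :
  ordered_nbhd x U -> nbhs x U.
Proof. by move=> [[oU _] Ux]; exact: open_nbhs_nbhs. Qed.

(** The order on the chart is that of the prescribed neighborhood U: a small box
in the given chart lies in a common subposet of both, and is itself a copy of
R^n. *)
Lemma euclidean_chart (E : locallyOrderedType) (e : E) (U : subposet E) :
  euclidean R n E -> ordered_nbhd e U ->
  exists k : 'rV[R]_n -> E, [/\ continuous k, k 0 = e, forall r, U (k r)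
    & forall r s, rV_le r s <-> sp_le U (k r) (k s)].
Proof.
move=> /(_ e)[V eV [h [k [hK kK _ ck hle]]]] eU.
have [S [eS [SU leSU] [SV leSV]]] := ordered_nbhd_join eU eV.
pose e0 : V := exist _ e (mem_set eV.2).
have ck' : continuous (set_val \o k).
  by move=> r; apply: continuous_comp; [exact: ck|exact: val_continuous].
have [d d0 boxS] : exists2 d, 0 < d & box (h e0) d `<=` (set_val \o k) @^-1` S.
  apply: (@nbhs_box R n); apply: ck' => /=; rewrite hK.
  exact: ordered_nbhd_nbhs.
have kS r : S (val (k (to_box (h e0) d r))) by apply: boxS; exact: to_box_in.
exists (set_val \o k \o to_box (h e0) d); split.
- move=> r; apply: continuous_comp; first exact: continuous_to_box.
  exact: ck'.
- by rewrite /= to_box0 hK.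
- by move=> r; exact: SU (kS r).
- move=> r s; rewrite -(to_box_le (h e0) d0).
  rewrite -{1}(kK (to_box _ _ r)) -{1}(kK (to_box _ _ s)) -hle.
  by rewrite -(leSU _ _ (kS r) (kS s)) (leSV _ _ (kS r) (kS s)).
Qed.

(** The inverse side of a chart, extended by 0 to a total function. *)
Lemma euclidean_coordinates (E : locallyOrderedType) (e : E) :
  euclidean R n E ->
  exists (V : subposet E) (h : E -> 'rV[R]_n), [/\ ordered_nbhd e V,
    forall y, V y -> {for y, continuous h}
    & forall y z, V y -> V z -> sp_le V y z <-> rV_le (h y) (h z)].
Proof.
move=> /(_ e)[V eV [h [k [hK kK ch _ hle]]]].
pose h' y := if pselect (V y) is left Vy then h (exist _ y (mem_set Vy)) else 0.
have h'E (u : V) : h' (val u) = h u.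
  rewrite /h'; case: pselect => [Vu|]; last by case; exact: (set_valP u).
  by congr h; exact: val_inj.
have h'V y (Vy : V y) : h' y = h (exist _ y (mem_set Vy)) by rewrite -h'E.
exists V, h'; split=> //.
- move=> y Vy N; rewrite (h'V _ Vy) => /(ch _)/nbhs_trace[O Oy ON].
  have : nbhs y (O `&` V).
    by apply: filterI => //; apply: open_nbhs_nbhs; split=> //; case: eV => -[].
  by apply: filterS => z [Oz Vz]; rewrite /preimage /= (h'V _ Vz); exact: ON.
- by move=> y z Vy Vz; rewrite (h'V _ Vy) (h'V _ Vz) -hle.
Qed.

(** Coordinates of the euclidean model of A, transported to X. That they embed
the order uses both directions of the isomorphism; the neighborhoods on which
each direction preserves the order have to be matched. *)
Lemma section_coordinates (X : locallyOrderedType) (A U : set X) (x : X) :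
  sections R n U A -> A x ->
  exists (W : subposet X) (h : X -> 'rV[R]_n), [/\ ordered_nbhd x W,
    forall y, A y -> W y -> h @ within A (nbhs y) --> h y
    & forall y z, A y -> A z -> W y -> W z ->
        sp_le W y z <-> rV_le (h y) (h z)].
Proof.
move=> [_ [E Eeu [f [g [fK gK [cf mf] [cg mg]]]]]] Ax.
pose a : A := exist _ x (mem_set Ax).
have [V [h [aV ch hle]]] := euclidean_coordinates (f a) Eeu.
have [Wf [aWf WfV f_mono]] := mf _ _ aV.
have [W0 [xW0 [W0f leW0f]]] := ordered_nbhd_of_trace aWf.
have aW0 : ordered_nbhd (g (f a)) (@sp_trace X A W0).
  by rewrite fK; exact: ordered_nbhd_trace.
have [V1 [aV1 V1W0 g_mono]] := mg _ _ aW0.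
have [S [[[oS _] aS] [SV leSV] [SV1 leSV1]]] := ordered_nbhd_join aV aV1.
have [O oO OS] : open (f @^-1` S) by move/continuousP : cf; exact.
have OSP (b : A) : O (val b) <-> S (f b).
  by rewrite -[S _]/((f @^-1` S) b) -OS.
pose h' y := if pselect (A y) is left Ay then h (f (exist _ y (mem_set Ay)))
  else 0.
have h'E (b : A) : h' (val b) = h (f b).
  rewrite /h'; case: pselect => [Ab|]; last by case; exact: (set_valP b).
  by congr (h (f _)); exact: val_inj.
exists (sp_restrict W0 O), h'; split.
- by apply: ordered_nbhd_restrict => //; exact/(OSP a).
- move=> y Ay [_ Oy]; pose b : A := exist _ y (mem_set Ay).
  have Sb : S (f b) by exact/OSP.
  move=> N; rewrite -[y]/(val b) h'E => bN.
  have /nbhs_trace[P Py PN] : nbhs b (f @^-1` (h @^-1` N)).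
    exact: cf (ch _ (SV _ Sb) _ bN).
  apply: (@filterS _ (nbhs y) _ P) => // z Pz Az /=.
  rewrite -[z]/(val (exist (fun x => x \in A) z (mem_set Az))) h'E.
  exact: PN.
- move=> y z Ay Az [Wy Oy] [Wz Oz].
  pose b : A := exist _ y (mem_set Ay); pose c : A := exist _ z (mem_set Az).
  have Sb : S (f b) by exact/OSP.
  have Sc : S (f c) by exact/OSP.
  rewrite -[y]/(val b) -[z]/(val c) !h'E -hle; [|exact: SV..].
  rewrite -leSV//; split=> /= [yz|/leSV1].
    apply/leSV => //; apply: f_mono; [exact: W0f..|].
    exact/leW0f.
  move=> /(_ Sb Sc)/(g_mono _ _ (SV1 _ Sb) (SV1 _ Sc)) /=.
  by rewrite !fK.
Qed.

End charts.

(** * Open sets mapped homeomorphically onto their image *)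

Section embeds_on.
Context {S T : topologicalType} (f : S -> T).

(** Phrased with images of open sets rather than with an inverse map: images are
what germs are made of. *)
Definition embeds_on (U : set S) := open U /\
  forall O, open O -> O `<=` U -> exists2 W, open W & f @` O = f @` U `&` W.

Lemma embeds_on_sub (U D : set S) :
  embeds_on U -> open D -> D `<=` U -> embeds_on D.
Proof.
move=> [oU fU] oD DU; split=> // O oO OD.
have [W oW OW] := fU _ oO (subset_trans OD DU).
exists W => //; rewrite eqEsubset; split=> y.
  move=> Oy; split; last by move: Oy; rewrite OW => -[].
  by case: Oy => a /OD Da <-; exists a.
by move=> [[a Da <-] Wa]; rewrite OW; split=> //; exists a => //; exact: DU.
Qed.

Lemma embeds_on_inverse (g : T -> S) (U : set S) : open U ->
  (forall a, U a -> g (f a) = a) -> {within f @` U, continuous g} ->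
  embeds_on U.
Proof.
move=> oU gK /continuousP cg; split=> // O oO OU.
have /open_subspaceP[W oW WO] := cg _ oO.
exists W => //; rewrite setIC WO eqEsubset; split=> y.
  move=> [a Oa <-]; have Ua := OU _ Oa; split; last by exists a.
  by rewrite /from_subspace /= gK.
by move=> [Ogy [a Ua ay]]; exists a => //; rewrite -(gK a Ua) ay.
Qed.

Lemma embeds_on_inverse_continuous (g : T -> S) (U : set S) : embeds_on U ->
  (forall a, U a -> g (f a) = a) ->
  continuous (g \o (set_val : (f @` U) -> T)).
Proof.
move=> [oU fU] gK; apply/continuousP => O oO.
have [W oW OW] := fU _ (openI oO oU) (@subIsetr _ _ _).
exists W => //; rewrite eqEsubset; split=> y /=.
  have [a Ua ay] : (f @` U) (set_val y) := set_valP y; rewrite -ay gK// => Wa.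
  have : (f @` (O `&` U)) (f a) by rewrite OW; split=> //; exists a.
  by move=> [b [Ob Ub] /(congr1 g)]; rewrite !gK// => <-.
have [a Ua ay] : (f @` U) (set_val y) := set_valP y; rewrite -ay gK// => Oa.
by have : (f @` (O `&` U)) (f a) by [exists a]; rewrite OW => -[].
Qed.

End embeds_on.

(** The image of the intersection of U and V is open in both images. *)
Lemma embeds_on_germ (S : topologicalType) (X : locallyOrderedType)
    (f : S -> X) (U V : set S) (e : S) :
  embeds_on f U -> embeds_on f V -> U e -> V e ->
  germ (f e) (f @` U) = germ (f e) (f @` V).
Proof.
move=> [oU fU] [oV fV] Ue Ve; apply/germE.
have oUV := openI oU oV.
have [O oO OU] := fU _ oUV (@subIsetl _ _ _).
have [P oP PV] := fV _ oUV (@subIsetr _ _ _).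
have fe : (f @` (U `&` V)) (f e) by exists e.
exists (O `&` P).
  apply: open_nbhs_nbhs; split; first exact: openI.
  by split; [move: fe; rewrite OU => -[]|move: fe; rewrite PV => -[]].
rewrite setIA -OU (setIC O) setIA -PV {1}PV -setIA setIid -PV.
by rewrite OU -setIA setIid.
Qed.

(** * Images of local embeddings *)

Section local_embeddings.
Context {E X : locallyOrderedType} (f : E -> X).

Definition order_embeds (U : subposet E) (V : subposet X) (g : X -> E) :=
  [/\ embeds_on f U, f @` U `<=` V, forall a, U a -> g (f a) = a
    & forall a b, U a -> U b -> sp_le U a b <-> sp_le V (f a) (f b)].

Lemma local_embedding_nbhd (e : E) (V : subposet X) (D : set E) :
  local_embedding f -> ordered_nbhd (f e) V -> nbhs e D ->
  exists (U : subposet E) (g : X -> E),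
    [/\ ordered_nbhd e U, U `<=` D & order_embeds U V g].
Proof.
move=> [_ f_emb] eV; rewrite nbhsE => -[O [oO Oe] OD].
have [U [[oU Ue] UV Um [g [gK cg gm]]]] := f_emb _ _ eV.
exists (sp_restrict U O), g; split.
- exact: ordered_nbhd_restrict.
- by move=> a [_ /OD].
- split.
  + apply: (embeds_on_sub (U := U)) => [||a []//].
      by apply: embeds_on_inverse gK cg; case: oU.
    by apply: openI => //; case: oU.
  + by move=> _ [a [Ua _] <-]; apply: UV; exists a.
  + by move=> a [Ua _]; exact: gK.
  + move=> a b [Ua _] [Ub _]; split; first exact: Um.
    by move=> /gm; rewrite !gK//; apply; [exists a|exists b].
Qed.

(** The map f, with inverse g, is an isomorphism of local orders from U to its
image, and U is euclidean as an open subset of E. *)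
Lemma image_section (R : realType) n (U : subposet E) (V : subposet X) g :
  euclidean R n E -> lo_morphism f -> ordered_open U -> ordered_open V ->
  order_embeds U V g -> sections R n V (f @` U).
Proof.
move=> Eeu mf oU oV [fU fUV gK fle]; split=> //.
exists (set_type U); first by apply: euclidean_open => //; case: oU.
have gU (y : f @` U) : g (val y) \in (U : set E).
  by apply/mem_set; have [a Ua <-] := set_valP y; rewrite gK.
have fa (a : U) : f (val a) \in f @` U.
  by apply/mem_set; exists (val a) => //; exact: (set_valP a).
exists (fun y => exist (fun a => a \in (U : set E)) _ (gU y)),
  (fun a => exist (fun y => y \in f @` U) _ (fa a)); split.
- move=> y; apply: val_inj => /=.
  by have [a Ua <-] := set_valP y; rewrite gK.
- by move=> a; apply: val_inj; rewrite /= gK//; exact: (set_valP a).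
- apply: lo_morphism_lift; split; first exact: embeds_on_inverse_continuous.
  move=> y W yW.
  have Ugy : U (g (set_val y)) by exact: (set_mem (gU y)).
  have [S [[[oS _] Sy] [SW leSW] [SU leSU]]] :=
    ordered_nbhd_join yW (conj oU Ugy).
  have [O oO OS] := fU.2 _ oS SU.
  have fUgE z : (f @` U) z -> f (g z) = z by move=> [a Ua <-]; rewrite gK.
  have OSP (z : f @` U) : O (val z) -> S (g (val z)).
    move=> Oz; have [a Sa az] : (f @` S) (val z).
      by rewrite OS; split=> //; exact: (set_valP z).
    by rewrite -az gK//; exact: SU.
  exists (sp_trace (f @` U) (sp_restrict V O)); split.
  + apply: ordered_nbhd_trace; apply: ordered_nbhd_restrict => //.
      by split=> //; apply: fUV; exact: (set_valP y).
    have : (f @` S) (val y).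
      by exists (g (val y)) => //; apply: fUgE; exact: (set_valP y).
    by rewrite OS => -[].
  + by move=> _ [z [_ /OSP/SW Wz] <-].
  + move=> b c [_ Ob] [_ Oc] /= bc.
    apply/leSW; [exact: OSP..|]; apply/leSU; [exact: OSP..|].
    apply/fle; [exact/SU/OSP..|].
    by rewrite !fUgE//; exact: set_valP.
- apply: lo_morphism_lift.
  apply: (@lo_morphism_comp _ _ _ (set_val : U -> E) f) => //.
  exact: lo_morphism_val.
Qed.

Lemma local_embedding_morphism : local_embedding f -> lo_morphism f.
Proof.
move=> [cf f_emb]; split=> // e V eV.
by have [U [eU UV Um _]] := f_emb e V eV; exists U.
Qed.

End local_embeddings.

(** * Germs and the blowup map *)

Section blowup_theory.
Context {R : realType} {n : nat} {X : locallyOrderedType}.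
Local Notation bundle := (germ_bundle R n X).
Local Notation blowup := (blowup R n X).
Local Notation beta := (@blowup_map R n X).

Lemma germ_base_nbhd (g : bundle) (W : set X) : nbhs (germ_pt g) W ->
  exists (U : subposet X) A, [/\ ordered_open U, sections R n U A, U `<=` W
    & sp_germs U A g].
Proof.
move=> gW; have [A [V [oV Vg VA]] gA] := germ_valP g.
have gVW : nbhs (germ_pt g) (V `&` W).
  by apply: filterI => //; exact: open_nbhs_nbhs.
have [U [gU UVW]] := ordered_nbhd_sub gVW.
have [oU Ug] := gU.
exists U, (A `&` U); split=> //.
- by apply: sections_restrict VA _ _; [case: oU|move=> y /UVW[]].
- by move=> y /UVW[].
- split=> //; rewrite -gA; apply/germE; exists U; last by rewrite -setIA setIid.
  exact: ordered_nbhd_nbhs gU.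
Qed.

Lemma nbhs_sp_germs (U : subposet X) A (g : bundle) :
  ordered_open U -> sections R n U A -> sp_germs U A g ->
  nbhs g (sp_germs U A : set bundle).
Proof.
move=> oU UA gUA; apply: open_nbhs_nbhs; split=> //.
by apply: ordered_base_open; exists U, A.
Qed.

Lemma germ_pt_continuous : continuous (@germ_pt R n X).
Proof.
move=> g W /germ_base_nbhd[U [A [oU UA UW gUA]]].
by apply: filterS (nbhs_sp_germs oU UA gUA) => h [/UW].
Qed.

Lemma blowup_map_continuous : continuous beta.
Proof.
move=> g; apply: (@continuous_comp _ _ _ set_val (@germ_pt R n X)).
  exact: val_continuous.
exact: germ_pt_continuous.
Qed.

Lemma germ_mem (x : X) (A B : set X) : germ x A = germ x B -> A x -> B x.
Proof.
move=> /germE[W xW AB] Ax; suff [] : (B `&` W) x by [].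
by rewrite -AB; split=> //; exact: nbhs_singleton.
Qed.

(** A set representing a germ in the blowup passes through its base point: this
is where the blowup differs from the bundle of all germs. *)
Lemma blowup_mem (g : blowup) A :
  germ_val (val g) = germ (beta g) A -> A (beta g).
Proof.
have [V [B [_ _ _ gB Bg]]] := set_valP g.
by move=> gA; apply: germ_mem Bg; rewrite -gB.
Qed.

(** * The lift to the blowup *)

Section lift.
Context {E : locallyOrderedType} (f : E -> X).

Definition germ_lift (ft : E -> blowup) := beta \o ft = f /\
  forall e U, embeds_on f U -> U e ->
    germ_val (val (ft e)) = germ (f e) (f @` U).

Hypothesis Eeu : euclidean R n E.
Hypothesis f_emb : local_embedding f.

Lemma germ_lift_exists : exists ft, germ_lift ft.
Proof.
suff /choice[ft ftP] e : exists g : blowup, beta g = f e /\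
    forall U, embeds_on f U -> U e -> germ_val (val g) = germ (f e) (f @` U).
  exists ft; split; first by apply/funext => e; have [] := ftP e.
  by move=> e; have [] := ftP e.
have [V [eV _]] := ordered_nbhd_sub (@filterT _ (nbhs (f e)) _).
have [U [g [[oU Ue] _ UVg]]] := local_embedding_nbhd f_emb eV filterT.
have VfU : sections R n V (f @` U).
  apply: (image_section (g := g)) => //; first exact: local_embedding_morphism.
  by case: eV.
have [[oV _] Ve] := eV.
have fU_stalk : stalk R n (f e) (germ (f e) (f @` U)).
  by exists (f @` U) => //; exists V.
pose b := GermBundle fU_stalk.
have bP : b \in @blowup_set R n X.
  by apply/mem_set; exists V, (f @` U); split=> //; exists e.
exists (exist _ b bP); split=> // U' fU' U'e.
by apply: embeds_on_germ => //; have [] := UVg.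
Qed.

(** If A has the germ of f(V) at f(e), it has that of f(V) at all nearby points,
and the lift takes the germ of f(V) at all points of V. *)
Lemma germ_lift_continuous ft : germ_lift ft -> continuous ft.
Proof.
move=> [ftf ftP] e N /nbhs_trace[M Mft MN].
have [_ [[B bB <-] Be BM]] := (@ordered_base_basis bundle).2 _ _ Mft.
have ft_pt a : germ_pt (val (ft a)) = f a by rewrite -ftf.
have [U [A [oU UA BE]]] : germ_base B := bB.
move: Be BM; rewrite {B bB}BE => -[/= Ue eA] BM.
rewrite ft_pt in Ue eA.
have [V [g [[oV Ve] _ [fV _ _ _]]]] :=
  local_embedding_nbhd f_emb (conj oU Ue) filterT.
have [W eW AW] : germ_eq (f e) A (f @` V).
  by apply/germE; rewrite -eA; exact: ftP.
move: eW; rewrite nbhsE => -[O [oO Oe] OW].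
have eUO : nbhs e (f @^-1` (U `&` O)).
  apply: f_emb.1; apply: filterI; last exact: open_nbhs_nbhs.
  exact: ordered_nbhd_nbhs (conj oU Ue).
have : nbhs e (V `&` f @^-1` (U `&` O)).
  by apply: filterI => //; exact: ordered_nbhd_nbhs (conj oV Ve).
apply: filterS => a [Va [Ua Oa]]; apply/MN/BM; split; rewrite /= ft_pt//.
rewrite (ftP _ _ fV Va); apply/germE/germ_eq_sym; exists O.
  exact: open_nbhs_nbhs.
by rewrite -(setIidr OW) !setIA AW.
Qed.

(** By continuity of ft, a neighborhood of e is mapped by f into a set A whose
germ at f(e) is ft(e). In coordinates on the source and on A, f becomes an
order embedding of R^n into itself, hence is open by [order_embedding_open], so
A is covered by the image of f near f(e). *)
Lemma continuous_lift_is_germ_lift ft :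
  continuous ft -> beta \o ft = f -> germ_lift ft.
Proof.
move=> cft ftf; split=> // e U fU Ue.
have ft_pt a : germ_pt (val (ft a)) = f a by rewrite -ftf.
have [V [A [oV VA _ eVA]]] :=
  germ_base_nbhd (@filterT _ (nbhs (germ_pt (val (ft e)))) _).
pose D := [set a | sp_germs V A (val (ft a))].
have eD : nbhs e D.
  exact: (cft e _
    (@val_continuous bundle _ (ft e) _ (nbhs_sp_germs oV VA eVA))).
have fDA a : D a -> A (f a).
  by move=> [_ aA]; rewrite -ft_pt; exact: blowup_mem.
have [W [h [eW ch hle]]] := section_coordinates VA (fDA _ (nbhs_singleton eD)).
have eDU : nbhs e (D `&` U).
  by apply: filterI => //; apply: open_nbhs_nbhs; split=> //; case: fU.
have [T [g [eT TDU [_ fTW _ fle]]]] := local_embedding_nbhd f_emb eW eDU.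
have [k [ck k0 kT kle]] := euclidean_chart Eeu eT.
have fkA r : A (f (k r)) by apply: fDA; have [] := TDU _ (kT r).
have fkW r : W (f (k r)) by apply: fTW; exists (k r).
(* k parametrizes a neighborhood of e and h gives coordinates on A, so the
   composite is f read in coordinates around e = k 0. *)
have : nbhs ((h \o f \o k) 0) (range (h \o f \o k)).
  apply: order_embedding_open.
    by move=> r s; rewrite kle fle//= hle.
  move=> r N /(ch _ (fkA r) (fkW r)) rN.
  have : nbhs r (k @^-1` (f @^-1` [set y | A y -> (h @^-1` N) y])).
    by apply: ck; apply: f_emb.1.
  by apply: filterS => s; apply; exact: fkA.
rewrite /= k0 => /(ch _ (fDA _ (nbhs_singleton eD)) eW.2) eO.
have AT y : A y -> W y -> range (h \o f \o k) (h y) -> (f @` T) y.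
  move=> Ay Wy [r _ /= hr]; exists (k r) => //.
  apply: (@sp_anti _ W) => //; apply/hle => //; rewrite hr => i; exact: lexx.
have [O oO OT] := fU.2 _ eT.1.1 (fun a Ta => (TDU a Ta).2).
rewrite (_ : germ_val _ = germ (f e) A); last by have [_] := eVA; rewrite ft_pt.
(* On the first two sets A lies in f(T), hence in f(U); on O, f(U) is f(T),
   which lies in A since T is contained in D. *)
apply/germE.
exists ([set y | A y -> (h @^-1` range (h \o f \o k)) y] `&` W `&` O).
  apply: filterI; first by apply: filterI => //; exact: ordered_nbhd_nbhs.
  apply: open_nbhs_nbhs; split=> //.
  have : (f @` T) (f e) by exists e => //; exact: eT.2.
  by rewrite OT => -[].
rewrite eqEsubset; split=> y [yA [[yh Wy] Oy]]; split=> //.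
  have : (f @` T) y by apply: AT => //; exact: yh.
  by rewrite OT => -[].
have : (f @` T) y by rewrite OT.
by move=> [a /TDU[/fDA Aa _] <-].
Qed.

Lemma germ_lift_unique ft ft' : germ_lift ft -> germ_lift ft' -> ft = ft'.
Proof.
move=> [ftf ftP] [ft'f ft'P]; apply/funext => e.
have pt a : germ_pt (val (ft a)) = f a by rewrite -ftf.
have pt' a : germ_pt (val (ft' a)) = f a by rewrite -ft'f.
have [V [eV _]] := ordered_nbhd_sub (@filterT _ (nbhs (f e)) _).
have [U [g [[oU Ue] _ [fU _ _ _]]]] := local_embedding_nbhd f_emb eV filterT.
apply/val_inj/germ_bundle_eq; first by rewrite pt pt'.
by rewrite (ftP _ _ fU Ue) (ft'P _ _ fU Ue).
Qed.

(** The order of the blowup near ft(e) is the order of X on base points, so a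
local inverse of f composed with the blowup map is one of ft. *)
Lemma lift_local_embedding ft :
  continuous ft -> beta \o ft = f -> local_embedding ft.
Proof.
move=> cft ftf; split=> // e V [[oV [_ [B bB <-] VB]] Ve].
have ft_pt a : germ_pt (val (ft a)) = f a by rewrite -ftf.
have [U [A [oU UA BE]]] : germ_base B := bB.
rewrite {B bB}BE in VB.
have Ue : U (f e) by have [/= + _] := VB.1 _ Ve; rewrite ft_pt.
have leV a b : V (ft a) -> V (ft b) ->
    sp_le V (ft a) (ft b) <-> sp_le U (f a) (f b).
  by move=> Va Vb; rewrite VB.2//= !ft_pt.
have [T [eT TU Tm [g [gK cg gm]]]] := f_emb.2 _ _ (conj oU Ue).
have oD : open (ft @^-1` V) by move/continuousP : cft; exact.
exists (sp_restrict T (ft @^-1` V)); split.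
- exact: ordered_nbhd_restrict.
- by move=> _ [a [_ Va] <-].
- by move=> a b [Ta Va] [Tb Vb] ab; apply/leV => //; exact: Tm.
have gbK a : T a -> g (beta (ft a)) = a.
  by move=> Ta; rewrite -[beta _]/((beta \o ft) a) ftf gK.
exists (g \o beta); split.
- by move=> a [Ta _]; exact: gbK.
- apply/subspace_continuousP => _ [a [Ta Va] <-] N.
  rewrite [X in nbhs X N -> _](gbK a Ta) => aN.
  have fTa : (f @` T) (f a) by exists a.
  have gaN : nbhs (g (f a)) N by rewrite gK.
  have /subspace_continuousP/(_ (f a) fTa N gaN) fN := cg.
  have : nbhs (ft a) (beta @^-1` [set y | (f @` T) y -> (g @^-1` N) y]).
    by apply: blowup_map_continuous; rewrite -[beta _]/((beta \o ft) a) ftf.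
  apply: filterS => c cN [b [Tb Vb] bc]; apply: cN.
  by rewrite -bc -[beta _]/((beta \o ft) b) ftf; exists b.
- move=> _ _ [a [Ta Va] <-] [b [Tb Vb] <-] /leV-/(_ Va Vb) ab.
  change (sp_le T (g (beta (ft a))) (g (beta (ft b)))).
  by rewrite !gbK//; have /gm := ab; rewrite !gK//; apply; [exists a|exists b].
Qed.

End lift.
End blowup_theory.

Theorem theorem4p8 (R : realType) (n : nat) (X E : locallyOrderedType)
    (f : E -> X) :
  euclidean R n E -> local_embedding f ->
  exists ft : E -> blowup R n X,
    unique (fun g : E -> blowup R n X =>
      continuous g /\ @blowup_map R n X \o g = f) ft /\
    local_embedding ft.
Proof.
move=> Eeu f_emb; have [ft ft_lift] := germ_lift_exists Eeu f_emb.
have cft := germ_lift_continuous f_emb ft_lift.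
exists ft; split; last exact: lift_local_embedding f_emb _ cft ft_lift.1.
split=> [|g [cg gf]]; first by split=> //; exact: ft_lift.1.
have g_lift := continuous_lift_is_germ_lift Eeu f_emb cg gf.
exact: (germ_lift_unique f_emb ft_lift g_lift).
Qed.
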